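(* $t(K(8,3)) =\frac{5}{3}$. Moreover, if $S$ is a vertex cut of $K(8,3)$ such that $\frac{|S|}{c(K(8,3)\setminus S)} = \frac{5}{3}$, then $S$ is the complement of a maximum independent set of $K(8,3)$.
   Context: The Kneser graph $K(n,k)$ has as vertices the $k$-element subsets of $[n]=\{1,\dots,n\}$, two vertices being adjacent iff they are disjoint. A vertex cut is a set $S$ of vertices whose removal disconnects the graph; $c(G\setminus S)$ is the number of connected components after deleting $S$; the toughness is $t(G)=\min_S |S|/c(G\setminus S)$ over vertex cuts $S$. *)

(* Defs.v *)
From mathcomp Require Import all_boot all_order all_algebra.
Set Implicit Arguments. Unset Strict Implicit. Unset Printing Implicit Defensive.
Import Order.TTheory GRing.Theory Num.Theory.

Definition kneser_vertex (n k : nat) := {A : {set 'I_n} | #|A| == k}.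

Definition kneser_adj (n k : nat) : rel (kneser_vertex n k) :=
  fun A B => [disjoint val A & val B].

Section GraphDefs.
Variables (T : finType) (e : rel T).

Definition del_rel (S : {set T}) : rel T :=
  fun x y => [&& x \notin S, y \notin S & e x y].

Definition components (S : {set T}) : {set {set T}} :=
  [set [set y | connect (del_rel S) x y] | x in ~: S].

Definition ncomp (S : {set T}) : nat := #|components S|.

Definition vertex_cut (S : {set T}) : Prop := 1 < ncomp S.

Definition is_toughness (t : rat) : Prop :=
  (exists S, vertex_cut S /\ (#|S|%:R / (ncomp S)%:R = t :> rat)%R) /\
  (forall S, vertex_cut S -> (t <= #|S|%:R / (ncomp S)%:R :> rat)%R).

Definition independent (I : {set T}) : Prop :=
  forall x y, x \in I -> y \in I -> ~~ e x y.

Definition maximum_independent (I : {set T}) : Prop :=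
  independent I /\ forall J, independent J -> #|J| <= #|I|.

End GraphDefs.

(* Main.v *)
(* Spectral proof. The adjacency matrix A of K(8,3) has eigenvalues 10, -6, 3, -1,
   the first one on constants, so that with s = sum f
     f'Af + 6 f'f >= (2/7) s^2   and   f'Af <= 3 f'f + s^2 / 8.
   Let the components K of the graph minus S have m_K vertices and average degree
   d_K. The first inequality, for f equal to 1 / (6 + d_K) on K, gives
   sum_K m_K / (6 + d_K) <= 7/2. The second one, applied to a combination of the
   indicators of K and of another component, gives d_K <= 3 + 3 m_K / 25. Together
   they imply 5 + 3 m_K <= 48 m_K / (6 + d_K), strictly unless m_K = 1; summing over
   the c components, 5 c + 3 (56 - |S|) <= 168, that is 5 c <= 3 |S|. In the equality
   case all components are single vertices, so the complement of S is an independent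
   set of size 21, and independent sets have size at most 21 by the first
   inequality. *)
Require Import Defs.
From mathcomp Require Import all_boot all_order all_algebra.
From mathcomp Require Import ring lra zify.
Import Order.TTheory GRing.Theory Num.Theory.
Set Implicit Arguments. Unset Strict Implicit. Unset Printing Implicit Defensive.
Local Open Scope ring_scope.

(** * Components after deleting vertices, and quadratic forms on them *)

Section Graph.
Variables (T : finType) (e : rel T).
Implicit Types (S K : {set T}) (f : T -> rat) (x y : T).

Definition adj x y : rat := (e x y)%:R.
Definition quad f : rat := \sum_x \sum_y f x * f y * adj x y.
(** In a graph each edge counts twice, so the average degree of [K] is [arcs K / #|K|]. *)
Definition arcs K : rat := \sum_(x in K) \sum_(y in K) adj x y.

Lemma arcs_ge0 K : 0 <= arcs K.
Proof. by apply: sumr_ge0 => x _; apply: sumr_ge0 => y _; rewrite ler0n. Qed.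

Lemma arcs_le K : irreflexive e -> arcs K <= #|K|%:R * (#|K|%:R - 1).
Proof.
move=> e_irr; rewrite mulr_natl -sumr_const.
apply: ler_sum => x xK; rewrite (bigD1 x) //= {1}/adj e_irr add0r.
rewrite (cardD1 x) xK mulrS addrC addrK -sumr_const.
rewrite [leRHS](eq_bigl (fun y => (y \in K) && (y != x))); last first.
  by move=> y; rewrite !inE andbC.
by apply: ler_sum => y _; rewrite /adj lern1; case: (e x y).
Qed.

Lemma sum_arcs_indic K : \sum_x \sum_y (x \in K)%:R * (y \in K)%:R * adj x y = arcs K.
Proof.
rewrite /arcs [RHS]big_mkcond; apply: eq_bigr => x _.
case: (x \in K); last by rewrite big1 // => y _; rewrite !mul0r.
rewrite [RHS]big_mkcond; apply: eq_bigr => y _.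
by case: (y \in K); rewrite !(mul1r, mul0r).
Qed.

Hypothesis e_sym : symmetric e.

Lemma del_connect_sym S : connect_sym (del_rel e S).
Proof.
apply: sym_connect_sym => x y.
by rewrite /del_rel e_sym andbCA.
Qed.

Lemma del_connect_compl S x y : x \notin S -> connect (del_rel e S) x y -> y \notin S.
Proof.
move=> xS /connectP[p]; elim: p x xS => [|z p IH] x xS /= => [_ ->//|].
by case/andP => /and3P[_ zS _] /IH; apply.
Qed.

Lemma components_equivalence S :
  components e S = equivalence_partition (connect (del_rel e S)) (~: S).
Proof.
apply: eq_in_imset => x; rewrite inE => xS.
apply/setP => y; rewrite !inE; case: (boolP (connect _ x y)) => [xy|]; last by rewrite andbF.
by rewrite (del_connect_compl xS xy).
Qed.

Lemma components_partition S : partition (components e S) (~: S).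
Proof.
rewrite components_equivalence; apply: equivalence_partitionP => x y z _ _ _.
split; first exact: connect0.
by move=> xy; apply: (same_connect (del_connect_sym S)).
Qed.

Lemma component_sub S K : K \in components e S -> {in K, forall x, x \notin S}.
Proof.
by case/imsetP => x; rewrite inE => xS -> y; rewrite inE; exact: del_connect_compl.
Qed.

Lemma component_card_gt0 S K : K \in components e S -> (0 < #|K|)%N.
Proof. by case/imsetP => x _ ->; apply/card_gt0P; exists x; rewrite inE. Qed.

Lemma component_closed S K x y :
  K \in components e S -> x \in K -> y \notin S -> e x y -> y \in K.
Proof.
move=> KP xK yS xy; have xS := component_sub KP xK.
case/imsetP: KP xK => z _ ->; rewrite !inE => zx.
by apply: connect_trans zx (connect1 _); rewrite /del_rel xS yS.
Qed.

(** The shape of the test vectors used in the spectral inequalities. *)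
Definition blockfun S (w : {set T} -> rat) x : rat :=
  if x \in S then 0 else w (pblock (components e S) x).

Lemma blockfun_in S w K x : K \in components e S -> x \in K -> blockfun S w x = w K.
Proof.
move=> KP xK; rewrite /blockfun (negPf (component_sub KP xK)).
by case/and3P: (components_partition S) => _ tr _; rewrite (def_pblock tr KP).
Qed.

Lemma sum_components S (F : T -> rat) : (forall x, x \in S -> F x = 0) ->
  \sum_x F x = \sum_(K in components e S) \sum_(x in K) F x.
Proof.
move=> F0; rewrite -(set_partition_big _ (components_partition S)).
rewrite [RHS]big_mkcond; apply: eq_bigr => x _; rewrite inE.
by case: (boolP (x \in S)) => //= /F0.
Qed.

Lemma sum_blockfun S w :
  \sum_x blockfun S w x = \sum_(K in components e S) w K * #|K|%:R.
Proof.
rewrite (sum_components (S := S)) => [|x xS]; last by rewrite /blockfun xS.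
apply: eq_bigr => K KP; rewrite (eq_bigr (fun=> w K)) => [|x]; last exact: blockfun_in.
by rewrite sumr_const mulr_natr.
Qed.

Lemma sum_blockfun_sq S w :
  \sum_x blockfun S w x ^+ 2 = \sum_(K in components e S) w K ^+ 2 * #|K|%:R.
Proof.
rewrite -(sum_blockfun S (fun K => w K ^+ 2)); apply: eq_bigr => x _.
by rewrite /blockfun; case: ifP; rewrite ?expr0n.
Qed.

(** Neighbours of a component that lie outside it belong to [S], where the function vanishes, so no
    mixed terms survive. *)
Lemma quad_blockfun S w :
  quad (blockfun S w) = \sum_(K in components e S) w K ^+ 2 * arcs K.
Proof.
rewrite /quad (sum_components (S := S)) => [|x xS]; last first.
  by rewrite big1 // => y _; rewrite /blockfun xS !mul0r.
apply: eq_bigr => K KP; rewrite /arcs mulr_sumr; apply: eq_bigr => x xK.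
rewrite mulr_sumr [RHS]big_mkcond; apply: eq_bigr => y _.
rewrite (blockfun_in _ KP xK); case: ifP => [yK|/negbT yK].
  by rewrite (blockfun_in _ KP yK) expr2.
rewrite {1}/blockfun; case: ifPn => yS; first by rewrite mulr0 mul0r.
rewrite /adj; case: (boolP (e x y)) => [xy|]; last by rewrite mulr0.
by rewrite (component_closed KP xK yS xy) in yK.
Qed.

Lemma components_independent I : independent e I -> components e (~: I) = set1 @: I.
Proof.
move=> indI; rewrite /components setCK; apply: eq_in_imset => x xI.
apply/setP => y; rewrite !inE; apply/idP/eqP => [|->]; last exact: connect0.
case/connectP => [[|z p]] /= => [_ ->//|]; case/andP => /and3P[].
by rewrite !inE !negbK => xI' zI xz; rewrite (negPf (indI _ _ xI' zI)) in xz.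
Qed.

Lemma ncomp_independent I : independent e I -> ncomp e (~: I) = #|I|.
Proof.
by move=> indI; rewrite /ncomp components_independent // card_imset //; exact: set1_inj.
Qed.

Lemma independent_singleton_components S :
  irreflexive e ->
  (forall K, K \in components e S -> #|K| = 1%N) -> independent e (~: S).
Proof.
move=> e_irr K1 x y; rewrite !inE => xS yS; apply/negP => xy.
pose K := [set z | connect (del_rel e S) x z].
have KP : K \in components e S by apply: imset_f; rewrite inE.
have xK : x \in K by rewrite inE.
have yK := component_closed KP xK yS xy.
have /eqP/cards1P[z Kz] := K1 _ KP.
by move: xK yK xy; rewrite Kz !inE => /eqP -> /eqP ->; rewrite e_irr.
Qed.

End Graph.

(** * Eigenspace projections of $K(8,3)$, checked by computation *)

Local Notation V := (kneser_vertex 8 3).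

Fixpoint words n : seq bitseq :=
  if n is n'.+1 then [seq b :: w | b <- [:: true; false], w <- words n'] else [:: [::]].
(** The 56 vertices as bit sequences, in evaluated form, so that matrix identities can be checked by
    [vm_compute]. *)
Definition triples : seq bitseq := Eval vm_compute in [seq w <- words 8 | count id w == 3].

Fixpoint inter (u v : bitseq) : nat :=
  match u, v with b :: u', c :: v' => ((b && c) + inter u' v')%N | _, _ => 0%N end.

(* The projections onto the eigenspaces of -6, 3 and -1 have as (A, B) entry
   [phi1 t / 120], [phi2 t / 84] and [phi3 t / 20], where [t] is the size of the
   intersection of A and B. *)
Definition phi1 (t : nat) : int := nth 0 [:: -9; -1; 7; 15] t.
Definition phi2 (t : nat) : int := nth 0 [:: 9; -5; 2; 30] t.
Definition phi3 (t : nat) : int := nth 0 [:: -1; 1; -2; 10] t.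

(** This is $M^2 = N M$ for the symmetric matrix $M$ with entries [phi (inter u v)]: $M/N$ is an
    orthogonal projection. *)
Definition idempotent_kernel (N : int) (phi : nat -> int) : bool :=
  all (fun u => all (fun v =>
    foldr (fun l s => phi (inter l u) * phi (inter l v) + s) 0 triples
      == N * phi (inter u v)) triples) triples.
Lemma phi1_idempotent : idempotent_kernel 120 phi1. Proof. by vm_compute. Qed.
Lemma phi2_idempotent : idempotent_kernel 84 phi2. Proof. by vm_compute. Qed.
Lemma phi3_idempotent : idempotent_kernel 20 phi3. Proof. by vm_compute. Qed.

Local Notation kn := (@kneser_adj 8 3).
Implicit Types (A B : V) (f : V -> rat).

Definition code A : bitseq := [seq i \in val A | i <- enum 'I_8].

Lemma words_size n (w : bitseq) : size w = n -> w \in words n.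
Proof.
elim: n w => [|n IH] [|b w] //= [/IH wn]; rewrite cats0 mem_cat.
by case: b; rewrite map_f ?orbT.
Qed.

Lemma triple_card A : #|val A| = 3%N.
Proof. exact/eqP/(valP A). Qed.

Lemma count_code A : count id (code A) = 3%N.
Proof.
by rewrite -(triple_card A) cardE /code count_map -size_filter enumT.
Qed.

Lemma code_triples A : code A \in triples.
Proof.
have -> : triples = [seq w <- words 8 | count id w == 3] by vm_compute.
by rewrite mem_filter count_code eqxx words_size // size_map size_enum_ord.
Qed.

Lemma inter_map (I : Type) (s : seq I) (p q : pred I) :
  inter (map p s) (map q s) = count (predI p q) s.
Proof. by elim: s => //= i s ->. Qed.

Lemma inter_code A B : inter (code A) (code B) = #|val A :&: val B|.
Proof.
rewrite inter_map -size_filter cardE enumT.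
by congr size; apply: eq_filter => i; rewrite [RHS]in_setI.
Qed.

Lemma idempotent_kernelP N phi u v : idempotent_kernel N phi -> u \in triples -> v \in triples ->
  \sum_(l <- triples) phi (inter l u) * phi (inter l v) = N * phi (inter u v).
Proof.
move=> /allP H uT vT; have /allP/(_ v vT)/eqP <- := H u uT.
by elim: triples => [|l s IH]; rewrite ?big_nil // big_cons IH.
Qed.

(** By idempotence and symmetry, $N f'Mf = |Mf|^2$. *)
Lemma projection_ge0 (N : int) phi f : 0 < N -> idempotent_kernel N phi ->
  0 <= \sum_A \sum_B f A * f B * (phi #|val A :&: val B|)%:~R.
Proof.
move=> N0 idem; rewrite -(pmulr_rge0 _ (x := N%:~R : rat)) ?ltr0z //.
have -> : N%:~R * (\sum_A \sum_B f A * f B * (phi #|val A :&: val B|)%:~R) =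
   \sum_(l <- triples) (\sum_A f A * (phi (inter l (code A)))%:~R) ^+ 2.
  rewrite mulr_sumr.
  under [RHS]eq_bigr => l _ do rewrite expr2 mulr_suml.
  rewrite exchange_big; apply: eq_bigr => A _ /=.
  under [RHS]eq_bigr => l _ do rewrite mulr_sumr.
  rewrite exchange_big mulr_sumr; apply: eq_bigr => B _ /=.
  rewrite mulrCA -inter_code -intrM.
  rewrite -(idempotent_kernelP idem (code_triples A) (code_triples B)).
  rewrite rmorph_sum mulr_sumr; apply: eq_bigr => l _ /=; rewrite intrM; ring.
by apply: sumr_ge0 => l _; exact: sqr_ge0.
Qed.

(** * The two spectral inequalities *)

Lemma inter_le3 A B : (#|val A :&: val B| <= 3)%N.
Proof. by rewrite (leq_trans (subset_leq_card (subsetIl _ _))) ?triple_card. Qed.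

Lemma inter_eq3 A B : (#|val A :&: val B| == 3)%N = (A == B).
Proof.
apply/eqP/eqP => [AB|->]; last by rewrite setIid (triple_card B).
apply: val_inj; apply/eqP; rewrite eqEcard (triple_card A) (triple_card B) leqnn andbT.
apply/setIidPl/eqP; by rewrite eqEcard subsetIl AB (triple_card A).
Qed.

Lemma adj_inter A B : kn A B = (#|val A :&: val B| == 0)%N.
Proof. by rewrite /kneser_adj -setI_eq0 cards_eq0. Qed.

Lemma kneser_sym : symmetric kn.
Proof. by move=> A B; rewrite /kneser_adj disjoint_sym. Qed.

Lemma kneser_irr : irreflexive kn.
Proof. by move=> A; rewrite adj_inter setIid (triple_card A). Qed.

Lemma double_sum_sq f : \sum_A \sum_B f A * f B = (\sum_A f A) ^+ 2.
Proof.
by rewrite expr2 mulr_suml; apply: eq_bigr => A _; rewrite mulr_sumr.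
Qed.

Lemma double_sum_diag f : \sum_A \sum_B f A * f B * (A == B)%:R = \sum_A f A ^+ 2.
Proof.
apply: eq_bigr => A _; rewrite (bigD1 A) //= eqxx mulr1 big1 ?addr0 ?expr2 // => B.
by rewrite eq_sym => /negPf ->; rewrite mulr0.
Qed.

(** Adjacency, identity and all-ones matrices all depend only on the intersection size, so a matrix
    identity reduces to the four cases $t = 0, \dots, 3$. *)
Lemma quad_comb f (a b c : rat) :
  a * quad kn f + b * (\sum_A f A ^+ 2) + c * (\sum_A f A) ^+ 2 =
  \sum_A \sum_B f A * f B *
     (let t := #|val A :&: val B| in a * (t == 0)%N%:R + b * (t == 3)%N%:R + c).
Proof.
rewrite -double_sum_sq -double_sum_diag /quad !mulr_sumr -!big_split /=.
apply: eq_bigr => A _; rewrite !mulr_sumr -!big_split /=.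
by apply: eq_bigr => B _; rewrite /adj adj_inter inter_eq3; ring.
Qed.

Lemma projection_comb f (phi psi : nat -> int) (a b : rat) :
  a * (\sum_A \sum_B f A * f B * (phi #|val A :&: val B|)%:~R) +
  b * (\sum_A \sum_B f A * f B * (psi #|val A :&: val B|)%:~R) =
  \sum_A \sum_B f A * f B *
     (let t := #|val A :&: val B| in a * (phi t)%:~R + b * (psi t)%:~R).
Proof.
rewrite !mulr_sumr -!big_split /=.
apply: eq_bigr => A _; rewrite !mulr_sumr -!big_split /=.
by apply: eq_bigr => B _; ring.
Qed.

(** With $J$ the all-ones matrix, $A + 6I - (2/7)J$ has eigenvalue 0 on constants and on the
    eigenspace of $-6$, 9 on that of 3 and 5 on that of $-1$. *)
Lemma quad_lower f :
  2%:R / 7%:R * (\sum_A f A) ^+ 2 <= quad kn f + 6%:R * \sum_A f A ^+ 2.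
Proof.
have h2 := projection_ge0 (N := 84) (phi := phi2) f isT phi2_idempotent.
have h3 := projection_ge0 (N := 20) (phi := phi3) f isT phi3_idempotent.
have E : 1 * quad kn f + 6%:R * (\sum_A f A ^+ 2) + (- (2%:R / 7%:R)) * (\sum_A f A) ^+ 2 =
  9%:R / 84%:R * (\sum_A \sum_B f A * f B * (phi2 #|val A :&: val B|)%:~R) +
  5%:R / 20%:R * (\sum_A \sum_B f A * f B * (phi3 #|val A :&: val B|)%:~R).
  rewrite quad_comb projection_comb; apply: eq_bigr => A _; apply: eq_bigr => B _.
  congr (_ * _) => /=; move: (inter_le3 A B).
  by case: #|_| => [|[|[|[|]]]] // _; vm_compute.
lra.
Qed.

(** Likewise $3I + J/8 - A$ has eigenvalue 0 on constants and on the eigenspace of 3, 9 on that of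
    $-6$ and 4 on that of $-1$. *)
Lemma quad_upper f :
  quad kn f <= 3%:R * (\sum_A f A ^+ 2) + 1 / 8%:R * (\sum_A f A) ^+ 2.
Proof.
have h1 := projection_ge0 (N := 120) (phi := phi1) f isT phi1_idempotent.
have h3 := projection_ge0 (N := 20) (phi := phi3) f isT phi3_idempotent.
have E : (-1) * quad kn f + 3%:R * (\sum_A f A ^+ 2) + (1 / 8%:R) * (\sum_A f A) ^+ 2 =
  9%:R / 120%:R * (\sum_A \sum_B f A * f B * (phi1 #|val A :&: val B|)%:~R) +
  4%:R / 20%:R * (\sum_A \sum_B f A * f B * (phi3 #|val A :&: val B|)%:~R).
  rewrite quad_comb projection_comb; apply: eq_bigr => A _; apply: eq_bigr => B _.
  congr (_ * _) => /=; move: (inter_le3 A B).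
  by case: #|_| => [|[|[|[|]]]] // _; vm_compute.
lra.
Qed.

(** For the indicator of [J] the lower bound reads $(2/7)|J|^2 \le 6|J|$. *)
Lemma independent_le21 (J : {set V}) : independent kn J -> (#|J| <= 21)%N.
Proof.
move=> indJ; have := quad_lower (fun x => (x \in J)%:R).
have J0 : arcs kn J = 0.
  apply: big1 => x xJ; apply: big1 => y yJ.
  by rewrite /adj (negPf (indJ _ _ xJ yJ)).
rewrite /quad sum_arcs_indic J0.
have sJ : \sum_x ((x \in J)%:R : rat) = #|J|%:R.
  by rewrite -natr_sum -big_mkcond sum1_card.
have qJ : \sum_x ((x \in J)%:R : rat) ^+ 2 = #|J|%:R.
  by rewrite -sJ; apply: eq_bigr => x _; case: (x \in J).
rewrite qJ sJ -(ler_nat rat) => H; rewrite leNgt; apply/negP => J21.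
by nra.
Qed.

(** * Size and average degree of the components of a cut *)

(** To be applied to a component with [n] vertices and [arcs] equal to [a]. *)
Lemma share_arith (R : realFieldType) (n : nat) (a : R) :
  (0 < n)%N -> 0 <= a -> a <= n%:R * (n%:R - 1) ->
  a <= 3%:R * n%:R + 3%:R / 25%:R * n%:R ^+ 2 ->
  n%:R / (6%:R * n%:R + a) * n%:R <= 7%:R / 2%:R ->
  5%:R + 3%:R * n%:R <= 48%:R * (n%:R / (6%:R * n%:R + a) * n%:R) ?= iff (n == 1%N).
Proof.
move=> n0 a0 am up.
have m1 : 1 <= n%:R :> R by rewrite ler1n.
have D0 : 0 < 6%:R * n%:R + a by lra.
rewrite [_ / _ * _]mulrAC ler_pdivrMr // => s72.
have [n1|n1] := eqVneq n 1%N.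
  have -> : a = 0 by move: am a0; rewrite n1; lra.
  by apply/leifP => /=; rewrite n1; apply/eqP; field; lra.
apply/leifP; rewrite mulrA ltr_pdivlMr //.
(* Size 2 is separate: there the general bound on [a] is too weak, but $a \le 2$ suffices. *)
have [n2|n2] := eqVneq n 2%N; first by move: am a0; rewrite n2; lra.
have m3 : 3%:R <= n%:R :> R by rewrite ler_nat; lia.
move: am up a0 s72 D0 m1 m3; move: (n%:R : R) => m am up a0 s72 D0 m1 m3.
(* From $m^2 \le (7/2)(6m + a)$ and $a \le 3m + 3m^2/25$. *)
have m55 : m <= 1575%:R / 29%:R by rewrite -(ler_pM2r (x := m)) //; lra.
(* Replacing [a] by its upper bound and dividing by [m] leaves $0.36 m^2 - 20.4 m + 45 < 0$; this
   convex quadratic is negative at both ends of $[3, 1575/29]$. *)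
have h1 : 0 <= (5%:R + 3%:R * m) * (3%:R * m + 3%:R / 25%:R * m ^+ 2 - a).
  by rewrite mulr_ge0 //; lra.
have h2 : 0 <= m * (1575%:R / 29%:R - m) by rewrite mulr_ge0 //; lra.
have h3 : 0 <= (m - 3%:R) * (m * (1575%:R / 29%:R - m)) by rewrite mulr_ge0 //; lra.
lra.
Qed.

Section Cut.
Variable S : {set V}.
Local Notation P := (components kn S).
Implicit Types K : {set V}.

(* [share K = m / (6 + d)] for a component with [m] vertices and average degree [d]. *)
Definition weight K : rat := #|K|%:R / (6%:R * #|K|%:R + arcs kn K).
Definition share K : rat := weight K * #|K|%:R.

Lemma card_ge1 K : K \in P -> 1 <= #|K|%:R :> rat.
Proof. by rewrite ler1n => /component_card_gt0. Qed.

Lemma share_ge0 K : 0 <= share K.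
Proof.
by rewrite /share /weight !(mulr_ge0, invr_ge0, addr_ge0) ?ler0n ?arcs_ge0.
Qed.

Lemma weight_denom_gt0 K : K \in P -> 0 < 6%:R * #|K|%:R + arcs kn K.
Proof. by move=> /card_ge1 m1; have := arcs_ge0 kn K; lra. Qed.

(** For the test vector given by [weight], its sum and the right side of [quad_lower] both equal the
    total share $t$, so $(2/7)t^2 \le t$. *)
Lemma sum_share_le : \sum_(K in P) share K <= 7%:R / 2%:R.
Proof.
have := quad_lower (blockfun kn S weight).
rewrite (quad_blockfun kneser_sym) (sum_blockfun_sq kneser_sym) (sum_blockfun kneser_sym).
rewrite mulr_sumr -big_split /=.
have -> : \sum_(K in P) (weight K ^+ 2 * arcs kn K + 6%:R * (weight K ^+ 2 * #|K|%:R)) =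
    \sum_(K in P) share K.
  apply: eq_bigr => K KP; have := weight_denom_gt0 KP.
  by rewrite /share /weight => D0; field; lra.
have : 0 <= \sum_(K in P) share K by apply: sumr_ge0 => K _; exact: share_ge0.
rewrite -[\sum_(K in P) weight K * _]/(\sum_(K in P) share K).
move: (\sum_(K in P) share K) => t t0 H; rewrite leNgt; apply/negP => t72.
by nra.
Qed.

Lemma share_le K : K \in P -> share K <= 7%:R / 2%:R.
Proof.
move=> KP; apply: le_trans sum_share_le; rewrite (bigD1 K) //= lerDl.
by apply: sumr_ge0 => L _; exact: share_ge0.
Qed.

Lemma arcs_upper K L : K \in P -> L \in P -> L != K ->
  arcs kn K <= 3%:R * #|K|%:R + 3%:R / 25%:R * #|K|%:R ^+ 2.
Proof.
move=> KP LP LK; have l1 := card_ge1 LP.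
(* The total of the test vector becomes $(24/25)|K|$. The factor $1/25$ minimizes $3\beta^2 +
   (1-\beta)^2/8$, with minimum $3/25$; this is the worst case $|L| = 1$. *)
pose b : rat := - (#|K|%:R / (25%:R * #|L|%:R)).
pose w M : rat := if M == K then 1 else if M == L then b else 0.
have sumw (G : rat -> {set V} -> rat) : (forall M, G 0 M = 0) ->
    \sum_(M in P) G (w M) M = G 1 K + G b L.
  move=> G0; rewrite (bigD1 K) //= (bigD1 L) /=; last by rewrite LP.
  rewrite big1 => [|M /andP[/andP[_ /negPf MK] /negPf ML]].
    by rewrite /w eqxx (negPf LK) eqxx addr0.
  by rewrite /w MK ML.
have := quad_upper (blockfun kn S w).
rewrite (quad_blockfun kneser_sym) (sum_blockfun_sq kneser_sym) (sum_blockfun kneser_sym).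
rewrite (sumw (fun r M => r ^+ 2 * arcs kn M)) => [|M]; last by rewrite expr0n mul0r.
rewrite (sumw (fun r M => r ^+ 2 * #|M|%:R)) => [|M]; last by rewrite expr0n mul0r.
rewrite (sumw (fun r M => r * #|M|%:R)) => [|M]; last by rewrite mul0r.
have -> : b * #|L|%:R = - (#|K|%:R / 25%:R) by rewrite /b; field; lra.
have bL : b ^+ 2 * #|L|%:R <= (#|K|%:R / 25%:R) ^+ 2.
  have -> : b ^+ 2 * #|L|%:R = (#|K|%:R / 25%:R) ^+ 2 * #|L|%:R^-1.
    by rewrite /b; field; lra.
  apply: ler_piMr (sqr_ge0 _) _; rewrite invf_le1 //; exact: lt_le_trans l1.
have : 0 <= b ^+ 2 * arcs kn L by rewrite mulr_ge0 ?sqr_ge0 ?arcs_ge0.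
lra.
Qed.

Lemma share_lower K L : K \in P -> L \in P -> L != K ->
  5%:R + 3%:R * #|K|%:R <= 48%:R * share K ?= iff (#|K| == 1%N).
Proof.
move=> KP LP LK; apply: share_arith (arcs_ge0 kn K) _ (arcs_upper KP LP LK) (share_le KP).
  exact: component_card_gt0 KP.
exact: (arcs_le K kneser_irr).
Qed.

Hypothesis cutS : vertex_cut kn S.

Lemma kneser_card : #|{: V}| = 56%N.
Proof. by rewrite card_sub -cardsE card_draws card_ord. Qed.

Lemma cut_bound :
  5%:R * (ncomp kn S)%:R <= 3%:R * #|S|%:R :> rat /\
  (5%:R * (ncomp kn S)%:R = 3%:R * #|S|%:R :> rat -> forall K, K \in P -> #|K| = 1%N).
Proof.
have H : \sum_(K in P) (5%:R + 3%:R * #|K|%:R) <= \sum_(K in P) 48%:R * share K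
    ?= iff [forall (K | K \in P), #|K| == 1%N].
  apply: leif_sum => K KP.
  (* The cut supplies the second component needed to bound the degree in [K]. *)
  have [L] : exists L, L \in P :\ K.
    by apply/card_gt0P; move: cutS; rewrite /vertex_cut /ncomp (cardsD1 K) KP.
  by rewrite !inE => /andP[LK LP]; exact: share_lower KP LP LK.
have cS : #|~: S|%:R = 56%:R - #|S|%:R :> rat.
  by rewrite -kneser_card -(cardsC S) natrD addrAC subrr add0r.
have sK : \sum_(K in P) #|K|%:R = 56%:R - #|S|%:R :> rat.
  by rewrite -natr_sum -(card_partition (components_partition kneser_sym S)).
move: H; rewrite big_split /= -!mulr_sumr sK.
rewrite sumr_const -[_ *+ #|_|]mulr_natr -/(ncomp _ _).
have := sum_share_le; move: (\sum_(K in P) _) => t t72 [H Heq].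
split=> [|E K KP]; first by lra.
(* The left side is now 168, which is also the upper bound $48 \cdot 7/2$ of the right side. *)
have /eqP : 5%:R * (ncomp kn S)%:R + 3%:R * (56%:R - #|S|%:R) = 48%:R * t by lra.
by rewrite Heq => /forallP/(_ K); rewrite KP => /eqP.
Qed.

End Cut.

(** * The extremal example and the equality case *)

(** Deleting the complement leaves 21 isolated vertices, with ratio $35/21 = 5/3$. *)
Definition star : {set V} := [set A : V | ord0 \in val A].

Lemma star_independent : independent kn star.
Proof.
move=> A B; rewrite !inE => A0 B0; rewrite /kneser_adj -setI_eq0.
by apply/set0Pn; exists ord0; rewrite inE A0.
Qed.

Lemma card_starC : #|~: star| = 35%N.
Proof.
rewrite -(card_imset _ val_inj).
have -> : val @: (~: star) = [set A : {set 'I_8} | A \subset ~: [set ord0] & #|A| == 3%N].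
  apply/setP => A; rewrite inE subsetC sub1set inE; apply/imsetP/andP => [[B]|[A0 A3]].
    by rewrite !inE => B0 ->; rewrite B0 triple_card.
  by exists (exist _ A A3); rewrite ?inE.
by rewrite cards_draws cardsC1 card_ord.
Qed.

Lemma card_star : #|star| = 21%N.
Proof. by have := cardsC star; rewrite card_starC kneser_card; lia. Qed.

Lemma ratio_ge (R : realFieldType) (s c : R) :
  0 < c -> 5%:R * c <= 3%:R * s -> 5%:R / 3%:R <= s / c.
Proof. by move=> c0 H; rewrite ler_pdivlMr //; lra. Qed.

Lemma ratio_eq (R : realFieldType) (s c : R) :
  0 < c -> s / c = 5%:R / 3%:R -> 5%:R * c = 3%:R * s.
Proof. by move=> c0 E; rewrite -[s](divfK (lt0r_neq0 c0)) E; field. Qed.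

Theorem theorem4p2 :
  is_toughness (@kneser_adj 8 3) (5%:R / 3%:R)%R /\
  (forall S : {set kneser_vertex 8 3},
     vertex_cut (@kneser_adj 8 3) S ->
     (#|S|%:R / (ncomp (@kneser_adj 8 3) S)%:R = 5%:R / 3%:R :> rat)%R ->
     exists I, maximum_independent (@kneser_adj 8 3) I /\ S = ~: I).
Proof.
have nstar : ncomp kn (~: star) = 21%N.
  by rewrite (ncomp_independent star_independent) card_star.
split; first split.
- by exists (~: star); rewrite /vertex_cut nstar card_starC.
- move=> S cutS; have [H _] := cut_bound cutS.
  have c0 : 0 < (ncomp kn S)%:R :> rat by rewrite ltr0n ltnW.
  exact: ratio_ge c0 H.
- move=> S cutS E; have [_ Heq] := cut_bound cutS.
  have c0 : 0 < (ncomp kn S)%:R :> rat by rewrite ltr0n ltnW.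
  have {}E : 5%:R * (ncomp kn S)%:R = 3%:R * #|S|%:R :> rat.
    exact: ratio_eq c0 E.
  have indU := independent_singleton_components kneser_irr (Heq E).
  exists (~: S); split; last by rewrite setCK.
  split=> // J /independent_le21 J21.
  (* The components are the single vertices of [~: S], so their number is 56 minus the size of
     [S]. *)
  have c21 (s c : nat) : (s + c = 56 -> 5 * c = 3 * s -> c = 21)%N by lia.
  rewrite (c21 #|S| #|~: S|) //; first by rewrite cardsC kneser_card.
  have := ncomp_independent indU; rewrite setCK => <-.
  by apply/eqP; rewrite -(eqr_nat rat) !natrM E.
Qed.
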